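(* Jordan equivalence does not imply the existence of a graph isomorphism: there exist $N$ and matrices $A,B\in\mathbb C^{N\times N}$ such that $\mathcal G(A)$ and $\mathcal G(B)$ are Jordan equivalent but there is no permutation matrix $T$ with $B=TAT^{-1}$.
   Context: $\mathcal G(A)$ is the (weighted, directed) graph with adjacency matrix $A\in\mathbb C^{N\times N}$. A Jordan decomposition of $A$ is $A=VJV^{-1}$, where $J=J_A$ is block diagonal with upper triangular Jordan blocks of size $r_{ij}$ for the distinct eigenvalues $\lambda_i$ ($i=1,\dots,k$, $j=1,\dots,g_i$, $g_i$ the geometric multiplicity) in a fixed order, and $V=[V_{ij}]$ is partitioned conformally, the columns of $V_{ij}\in\mathbb C^{N\times r_{ij}}$ being a Jordan chain of $\lambda_i$. $\mathcal G(A)$ and $\mathcal G(B)$, with Jordan decompositions $A=VJ_AV^{-1}$ and $B=XJ_BX^{-1}$, are Jordan equivalent if (1) $J_A=J_B$ (for a fixed ordering of the Jordan blocks) and (2) their Jordan subspaces agree: $\mathrm{span}\{V_{ij}\}=\mathrm{span}\{X_{ij}\}$ (column spans) for all $i,j$. Two graphs $\mathcal G(A),\mathcal G(B)$ are isomorphic if $B=TAT^{-1}$ for a permutation matrix $T$. *)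

(* Defs.v *)
From mathcomp Require Import all_boot all_order all_algebra.
From mathcomp Require Import reals complex.

Set Implicit Arguments.
Unset Strict Implicit.
Unset Printing Implicit Defensive.

Import GRing.Theory.
Local Open Scope ring_scope.

(* A weighted digraph is represented by its adjacency matrix. *)

Definition jordan_block (F : fieldType) (n : nat) (a : F) : 'M[F]_n :=
  \matrix_(i, j) (a *+ (i == j) + (i.+1 == j :> nat)%:R).

(* The eigenvalues, in a fixed order, and for each of them the sizes of its
   Jordan blocks, also in a fixed order.  Since the blocks are nonempty and the
   jeigen are distinct, jgeom i is the geometric multiplicity of jeigen i. *)
Record jordan_type (F : fieldType) := JordanType {
  jnum : nat;
  jeigen : 'I_jnum -> F;
  jgeom : 'I_jnum -> nat;
  jsize : forall i : 'I_jnum, 'I_(jgeom i) -> nat;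
  jeigen_inj : injective jeigen;
  jgeom_gt0 : forall i, (0 < jgeom i)%N;
  jsize_gt0 : forall i j, (0 < @jsize i j)%N
}.

Section Jordan.
Variable F : fieldType.
Implicit Type t : jordan_type F.

Definition jordan_dim t : nat :=
  (\sum_(i < jnum t) \sum_(j < jgeom i) jsize j)%N.

Definition jordan_mx t : 'M[F]_(jordan_dim t) :=
  \mxdiag_(i < jnum t) \mxdiag_(j < jgeom i) jordan_block (jsize j) (jeigen i).

(* The columns of V that are multiplied by the (i, j) Jordan block. *)
Definition jordan_cols t N (e : jordan_dim t = N) (V : 'M[F]_N)
    (i : 'I_(jnum t)) (j : 'I_(jgeom i)) : 'M[F]_(N, jsize j) :=
  submxrow (submxrow (castmx (erefl N, esym e) V) i) j.

Definition jordan_decomposition t N (e : jordan_dim t = N)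
    (A V : 'M[F]_N) : Prop :=
  V \in unitmx /\ A = V *m castmx (e, e) (jordan_mx t) *m invmx V.

(* J_A = J_B is expressed by sharing t: as the eigenvalues in t are distinct and
   the blocks nonempty, the matrix determines t.  %MS compares row spaces, hence
   the transposes. *)
Definition jordan_equivalent N (A B : 'M[F]_N) : Prop :=
  exists t (e : jordan_dim t = N) (V X : 'M[F]_N),
    [/\ jordan_decomposition e A V,
        jordan_decomposition e B X &
        forall (i : 'I_(jnum t)) (j : 'I_(jgeom i)),
          ((jordan_cols e V j)^T :=: (jordan_cols e X j)^T)%MS].

Definition graph_isomorphic N (A B : 'M[F]_N) : Prop :=
  exists2 T : 'M[F]_N, is_perm_mx T & B = T *m A *m invmx T.

End Jordan.

(* Main.v *)
(* Take A = J_2(0), with Jordan basis the identity.  Multiplying the vectors of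
   a Jordan chain of a nilpotent block by 1, 2, 4, ... does not change their
   span but divides the matrix by 2, so A = 2B for a matrix B that is Jordan
   equivalent to A.  Conjugation by a permutation matrix preserves the trace of
   A^T A, which is 1 for A and 1/4 for B. *)
Require Import Defs.
From mathcomp Require Import all_boot all_order all_algebra fingroup perm.
From mathcomp Require Import reals complex.

Local Open Scope ring_scope.
Local Open Scope complex_scope.

Import GRing.Theory Num.Theory.

Lemma mul_mxdiag (R : pzSemiRingType) (n : nat) (p : 'I_n -> nat)
    (A B : forall i, 'M[R]_(p i)) :
  (\mxdiag_i A i) *m (\mxdiag_i B i) = \mxdiag_i (A i *m B i).
Proof.
rewrite {2 3}/mxdiag mul_mxdiag_mxblock; apply/eq_mxblock => i j.
by case: eqVneq => [<-|_]; rewrite ?conform_mx_id // mulmx0.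
Qed.

Lemma submxrow_mul_mxdiag (R : pzSemiRingType) (n m : nat) (p : 'I_n -> nat)
    (A : 'M[R]_(m, \sum_i p i)) (D : forall i, 'M[R]_(p i)) (i : 'I_n) :
  submxrow (A *m \mxdiag_i D i) i = submxrow A i *m D i.
Proof. by rewrite -{1}(submxrowK A) mul_mxrow_mxdiag mxrowK. Qed.

(** A permutation matrix is orthogonal, so the inner factors of [B^T *m B] cancel, and cyclicity of
    the trace removes the outer ones. *)
Lemma mxtrace_trmul_perm (R : comNzRingType) (n : nat) (s : 'S_n)
    (A : 'M[R]_n) :
  let B := perm_mx s *m A *m perm_mx s^-1%g in \tr (B^T *m B) = \tr (A^T *m A).
Proof.
rewrite /= !trmx_mul !tr_perm_mx invgK -!mulmxA.
rewrite (mulmxA (perm_mx s^-1%g)) -perm_mxM mulVg perm_mx1 mul1mx.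
by rewrite mxtrace_mulC -!mulmxA -perm_mxM mulVg perm_mx1 mulmx1.
Qed.

Lemma graph_isomorphic_mxtrace (F : fieldType) (n : nat) (A B : 'M[F]_n) :
  graph_isomorphic A B -> \tr (B^T *m B) = \tr (A^T *m A).
Proof.
case=> T /is_perm_mxP[s ->] ->.
suff -> : invmx (perm_mx s) = perm_mx s^-1%g :> 'M[F]_n.
  exact: mxtrace_trmul_perm.
apply: (can_inj (mulKmx (unitmx_perm F s))).
by rewrite mulmxV ?unitmx_perm // -perm_mxM mulgV perm_mx1.
Qed.

Section ChainRescaling.
Variables (F : numFieldType) (t : jordan_type F).

(** [D] depends on the block size alone, so identities between such matrices reduce to one block of
    arbitrary size. *)
Definition jordan_mxdiag
    (D : forall n, 'M[F]_n) : 'M[F]_(jordan_dim t) :=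
  \mxdiag_(i < jnum t) \mxdiag_(j < jgeom i) D (jsize j).

Lemma mul_jordan_mxdiag (D E : forall n, 'M[F]_n) :
  jordan_mxdiag D *m jordan_mxdiag E = jordan_mxdiag (fun n => D n *m E n).
Proof. by rewrite mul_mxdiag; apply/eq_mxdiag => i; apply: mul_mxdiag. Qed.

Lemma jordan_mxdiag1 : jordan_mxdiag (fun n => 1%:M) = 1%:M.
Proof.
rewrite /jordan_mxdiag -mxdiagZ; apply/eq_mxdiag => i; exact: mxdiagZ.
Qed.

Lemma eq_jordan_mxdiag (D E : forall n, 'M[F]_n) :
  (forall n, D n = E n) -> jordan_mxdiag D = jordan_mxdiag E.
Proof. by move=> DE; apply/eq_mxdiag => i; apply/eq_mxdiag => j. Qed.

Definition chain_scaling n : 'M[F]_n := diag_mx (\row_i 2 ^+ i).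

Definition chain_unscaling n : 'M[F]_n := diag_mx (\row_i 2 ^- i).

Lemma chain_scalingK n : chain_scaling n *m chain_unscaling n = 1%:M.
Proof.
apply/matrixP => i j; rewrite mul_diag_mx !mxE.
by case: eqP => [->|_]; rewrite ?mulr0 // mulr1n divff ?expf_neq0 ?pnatr_eq0.
Qed.

(** Only the entries [(i, i+1)] can be nonzero; there the identity reads [2^(i+1) = 2^i + 2^i]. *)
Lemma jordan_block_chain_scaling n :
  jordan_block n 0 *m chain_scaling n =
  chain_scaling n *m jordan_block n 0 + chain_scaling n *m jordan_block n 0.
Proof.
apply/matrixP => i j.
rewrite mul_mx_diag mul_diag_mx !mxE mul0rn add0r.
case: eqP => [<-|_]; last by rewrite mulr0 mul0r addr0.
by rewrite exprS mul1r mulr1 mulrDl mul1r.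
Qed.

Hypothesis t0 : forall i : 'I_(jnum t), jeigen i = 0.

Lemma jordan_mxE : jordan_mx t = jordan_mxdiag (fun n => jordan_block n 0).
Proof. by apply/eq_mxdiag => i; apply/eq_mxdiag => j; rewrite t0. Qed.

Lemma nilpotent_jordan_equivalent_half :
  exists2 B : 'M[F]_(jordan_dim t),
    jordan_equivalent (jordan_mx t) B & jordan_mx t = B + B.
Proof.
pose X := jordan_mxdiag chain_scaling.
have /mulmx1_unit[uX _] : X *m jordan_mxdiag chain_unscaling = 1%:M.
  rewrite mul_jordan_mxdiag -jordan_mxdiag1.
  exact/eq_jordan_mxdiag/chain_scalingK.
exists (X *m jordan_mx t *m invmx X).
  exists t, erefl, 1%:M, X; split.
  - by split; rewrite ?unitmx1 // castmx_id invmx1 mulmx1 mul1mx.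
  - by split; rewrite // castmx_id.
  (* The columns of [X] for a block are those of the identity times an invertible [chain_scaling],
     hence have the same span. *)
  move=> i j; rewrite /jordan_cols !castmx_id -[X]mul1mx.
  rewrite !submxrow_mul_mxdiag trmx_mul.
  apply/eqmx_sym/eqmxMfull; rewrite row_full_unit unitmx_tr.
  by case/mulmx1_unit: (chain_scalingK (jsize j)).
(* After multiplication by [X] on the right, the claim [J = B + B] becomes [J X = X J + X J], which
   is checked block by block. *)
apply: (can_inj (mulmxK uX)).
rewrite [RHS]mulmxDl (mulmxKV uX) jordan_mxE.
rewrite [LHS]mul_jordan_mxdiag mul_jordan_mxdiag.
rewrite /jordan_mxdiag -mxdiagD; apply/eq_mxdiag => i.
by rewrite -mxdiagD; apply/eq_mxdiag => j; apply: jordan_block_chain_scaling.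
Qed.

(** This spares the example from computing entries of nested block diagonal matrices. *)
Lemma jordan_mx_trace :
  \tr ((jordan_mx t)^T *m jordan_mx t) =
  \sum_(i < jnum t) \sum_(j < jgeom i)
    \tr ((jordan_block (jsize j) 0)^T *m jordan_block (jsize j) 0) :> F.
Proof.
rewrite jordan_mxE /jordan_mxdiag tr_mxdiag mul_mxdiag mxtrace_mxdiag.
apply: eq_bigr => i _.
by rewrite tr_mxdiag mul_mxdiag mxtrace_mxdiag.
Qed.

End ChainRescaling.

Lemma ord1_inj (T : Type) (f : 'I_1 -> T) : injective f.
Proof. by move=> i j _; rewrite !ord1. Qed.

(** Size 2 is the smallest for which a nilpotent Jordan block is nonzero, hence differs from its
    half. *)
Definition nilpotent_block2 (F : fieldType) : jordan_type F :=
  @JordanType F 1 (fun=> 0) (fun=> 1) (fun _ _ => 2)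
    (@ord1_inj F _) (fun=> isT) (fun _ _ => isT).

Theorem theorem9 (R : realType) :
  exists (N : nat) (A B : 'M[R[i]]_N),
    jordan_equivalent A B /\ ~ graph_isomorphic A B.
Proof.
pose t := nilpotent_block2 R[i].
have [B eqAB A2B] := @nilpotent_jordan_equivalent_half _ t (fun=> erefl).
exists (jordan_dim t), (jordan_mx t), B; split=> // /graph_isomorphic_mxtrace.
(* The trace is the sum of the squared entries, and the only nonzero entry is a 1. *)
have : \tr ((jordan_mx t)^T *m jordan_mx t) = 1.
  rewrite jordan_mx_trace // !big_ord1 /mxtrace !big_ord_recl big_ord0 /=.
  rewrite !mxE !big_ord_recl !big_ord0 !mxE /=.
  by rewrite !mul0rn !(mulr0, mulr1, addr0, add0r).
move=> A1; rewrite A1 => B1; move: A1.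
(* Expanding [A = B + B] gives four copies of the trace for [B]; if that were also 1, then [4 = 1],
   impossible in characteristic 0. *)
rewrite A2B mulmxDr [(B + B)^T]linearD /= mulmxDl !mxtraceD B1.
by move/eqP; rewrite -!mulr2n -mulrnA pnatr_eq1.
Qed.
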